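(* Let $\mathbb{K}$ be a commutative ring with identity, let $(A,[-,-])$ be a Lie $\mathbb{K}$-affgebra and let $N$ be a Nijenhuis operator on $(A,[-,-])$. Let $o\in A$ and let $(A_o,[-,-]_o)$ be the Lie $\mathbb{K}$-algebra with $$[a,b]_o=\langle [a,b],[a,o],[o,o],[o,b],o\rangle=[a,b]-[a,o]+[o,o]-[o,b].$$ Define $N_o:A_o\to A_o$ by $N_o a=\langle Na,No,o\rangle=Na-No$. Then $N_o$ is a Nijenhuis operator on the Lie algebra $(A_o,[-,-]_o)$.
   Context: An abelian heap is a set $A$ with a ternary operation $\langle -,-,-\rangle:A^3\to A$ such that for all $a,b,c,d,e\in A$: $\langle\langle a,b,c\rangle,d,e\rangle=\langle a,b,\langle c,d,e\rangle\rangle$, $\langle a,b,b\rangle=a=\langle b,b,a\rangle$, $\langle a,b,c\rangle=\langle c,b,a\rangle$. Heap homomorphisms are maps preserving the ternary operation. One writes $\langle a_1,\ldots,a_{2n+1}\rangle:=\langle\ldots\langle\langle a_1,a_2,a_3\rangle,a_4,a_5\rangle,\ldots,a_{2n+1}\rangle$. An affine $\mathbb{K}$-module ($\mathbb{K}$ a commutative ring with identity) is a non-empty abelian heap $A$ with a map $\mathbb{K}\times A\times A\to A$, $(\alpha,a,b)\mapsto\alpha\triangleright_a b$, such that for all $a,b,c\in A$, $\alpha,\beta\in\mathbb{K}$: (a) $\alpha\triangleright_a-:A\to A$ and $-\triangleright_a b:\mathbb{K}\to A$ are heap homomorphisms, where $\mathbb{K}$ is a heap via $\alpha-\beta+\gamma$;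 (b) $(\alpha\beta)\triangleright_a b=\alpha\triangleright_a(\beta\triangleright_a b)$; (c) $\alpha\triangleright_a b=\langle\alpha\triangleright_c b,\alpha\triangleright_c a,a\rangle$; (d) $0\triangleright_a b=a$ and $1\triangleright_a b=b$. A homomorphism of affine $\mathbb{K}$-modules (affine map) is a heap homomorphism $f$ with $f(\alpha\triangleright_a b)=\alpha\triangleright_{f(a)}f(b)$. A map $A\times A\to A$ is bi-affine if it is an affine map in each argument separately. For $o\in A$, $A_o$ denotes the $\mathbb{K}$-module with underlying set $A$, addition $a+b=\langle a,o,b\rangle$, zero $o$ and scalar multiplication $\alpha a=\alpha\triangleright_o a$; the symbols $+,-$ above refer to $A_o$. A Lie bracket on an affine $\mathbb{K}$-module $A$ (by convention, a left Lie bracket) is a bi-affine map $[-,-]:A\times A\to A$ such that for all $a,b,c\in A$: $\langle [a,b],[a,a],[b,a]\rangle=[b,b]$ and $\langle [a,[b,c]],[a,a],[b,[c,a]],[b,b],[c,[a,b]]\rangle=[c,c]$. An affine $\mathbb{K}$-module with a Lie bracket is called a Lie $\mathbb{K}$-affgebra. For every Lie affgebra, $(A_o,[-,-]_o)$ is a Lie $\mathbb{K}$-algebra. A Nijenhuis operator on a Lie affgebra $(A,[-,-])$ is an affine map $N:A\to A$ such that for all $a,b\in A$: $[Na,Nb]=N\big(\langle [Na,b],N[a,b],[a,Nb]\rangle\big)$. A Nijenhuis operator on a Lie $\mathbb{K}$-algebra $(L,[-,-])$ is a $\mathbb{K}$-linear map $T:L\to L$ with $[Tx,Ty]=T\big([Tx,y]-T[x,y]+[x,Ty]\big)$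 for all $x,y\in L$. *)

(* Defs.v *)
From HB Require Import structures.
From mathcomp Require Import all_boot all_algebra.
From mathcomp Require Import boolp.

Set Implicit Arguments.
Unset Strict Implicit.
Unset Printing Implicit Defensive.

Import GRing.Theory.
Local Open Scope ring_scope.

HB.mixin Record isAbelianHeap A := {
  heap : A -> A -> A -> A;
  heapA : forall a b c d e, heap (heap a b c) d e = heap a b (heap c d e);
  heapKr : forall a b, heap a b b = a;
  heapKl : forall a b, heap b b a = a;
  heapC : forall a b c, heap a b c = heap c b a
}.

#[short(type="abelianHeapType")]
HB.structure Definition AbelianHeap := {A of isAbelianHeap A}.

Definition heap5 (A : abelianHeapType) (a1 a2 a3 a4 a5 : A) : A :=
  heap (heap a1 a2 a3) a4 a5.

Definition heap_morphism (A B : abelianHeapType) (f : A -> B) : Prop :=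
  forall a b c, f (heap a b c) = heap (f a) (f b) (f c).

(* An alias, so that the heap instance does not fire on every zmodType. *)
Definition zmod_heap (V : zmodType) : Type := V.

Section ZmodHeap.
Variable V : zmodType.
Let h (x y z : V) : V := x - y + z.
Fact zmod_heapA a b c d e : h (h a b c) d e = h a b (h c d e).
Proof. by rewrite /h !addrA. Qed.
Fact zmod_heapKr a b : h a b b = a. Proof. exact: subrK. Qed.
Fact zmod_heapKl a b : h b b a = a. Proof. by rewrite /h subrr add0r. Qed.
Fact zmod_heapC a b c : h a b c = h c b a.
Proof. by rewrite /h addrC addrA addrAC. Qed.
HB.instance Definition _ :=
  isAbelianHeap.Build (zmod_heap V) zmod_heapA zmod_heapKr zmod_heapKl zmod_heapC.
End ZmodHeap.

(* [act alpha a b] is alpha |>_a b. *)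
HB.mixin Record AbelianHeap_isAffineModule (K : comPzRingType) A
    of AbelianHeap A := {
  affine_inhabited : inhabited A;
  act : K -> A -> A -> A;
  act_heapr : forall alpha a, heap_morphism (act alpha a);
  act_heapl : forall a b,
    heap_morphism (fun alpha : zmod_heap K => act alpha a b);
  actM : forall alpha beta a b,
    act (alpha * beta) a b = act alpha a (act beta a b);
  act_base : forall alpha a b c,
    act alpha a b = heap (act alpha c b) (act alpha c a) a;
  act0 : forall a b, act 0 a b = a;
  act1 : forall a b, act 1 a b = b
}.

#[short(type="affineModType")]
HB.structure Definition AffineModule (K : comPzRingType) :=
  {A of AbelianHeap_isAffineModule K A & isAbelianHeap A}.

Definition affine_morphism (K : comPzRingType) (A B : affineModType K)
    (f : A -> B) : Prop :=
  heap_morphism f /\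
  forall (alpha : K) a b, f (act alpha a b) = act alpha (f a) (f b).

Definition biaffine (K : comPzRingType) (A : affineModType K)
    (f : A -> A -> A) : Prop :=
  (forall a, affine_morphism (f a)) /\ (forall b, affine_morphism (f^~ b)).

HB.mixin Record AffineModule_isLieAffgebra (K : comPzRingType) A
    of AffineModule K A := {
  abr : A -> A -> A;
  abr_biaffine : biaffine abr;
  abr_antisym : forall a b, heap (abr a b) (abr a a) (abr b a) = abr b b;
  abr_jacobi : forall a b c,
    heap5 (abr a (abr b c)) (abr a a) (abr b (abr c a)) (abr b b)
          (abr c (abr a b)) = abr c c
}.

#[short(type="lieAffgebraType")]
HB.structure Definition LieAffgebra (K : comPzRingType) :=
  {A of AffineModule_isLieAffgebra K A & AffineModule K A}.

HB.mixin Record Lmodule_isLieAlgebra (K : comPzRingType) L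
    of GRing.Lmodule K L := {
  lie : L -> L -> L;
  lie_linearr : forall x, linear (lie x);
  lie_linearl : forall y, linear (lie^~ y);
  liexx : forall x, lie x x = 0;
  lie_jacobi : forall x y z,
    lie x (lie y z) + lie y (lie z x) + lie z (lie x y) = 0
}.

#[short(type="lieAlgType")]
HB.structure Definition LieAlgebra (K : comPzRingType) :=
  {L of Lmodule_isLieAlgebra K L & GRing.Lmodule K L}.

Definition affgebra_nijenhuis (K : comPzRingType) (A : lieAffgebraType K)
    (N : A -> A) : Prop :=
  affine_morphism N /\
  forall a b, abr (N a) (N b) =
    N (heap (abr (N a) b) (N (abr a b)) (abr a (N b))).

Definition lie_nijenhuis (K : comPzRingType) (L : lieAlgType K)
    (T : L -> L) : Prop :=
  linear T /\
  forall x y, lie (T x) (T y) = T (lie (T x) y - T (lie x y) + lie x (T y)).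

(* [based o] is the carrier of A_o; its decidable equality and choice operator,
   required by lmodType, are the classical ones. *)
Definition based (K : comPzRingType) (A : affineModType K) (o : A) : Type := A.

Section BasedModule.
Variables (K : comPzRingType) (A : affineModType K) (o : A).

HB.instance Definition _ := gen_eqMixin (based o).
HB.instance Definition _ := gen_choiceMixin (based o).

Let add (a b : A) : A := heap a o b.
Let opp (a : A) : A := heap o a o.

Fact based_addA : associative add.
Proof. by move=> a b c; rewrite /add heapA. Qed.
Fact based_addC : commutative add.
Proof. by move=> a b; rewrite /add heapC. Qed.
Fact based_add0 : left_id o add.
Proof. by move=> a; rewrite /add heapKl. Qed.
Fact based_addN : left_inverse o opp add.
Proof. by move=> a; rewrite /add /opp heapA heapKl heapKr. Qed.

HB.instance Definition _ := GRing.isZmodule.Build (based o)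
  based_addA based_addC based_add0 based_addN.

Lemma actaa (alpha : K) (a : A) : act alpha a a = a.
Proof. by rewrite (act_base alpha a a a) heapKl. Qed.

Let scale (alpha : K) (a : based o) : based o := act alpha o a.

Fact based_scaleA alpha beta v :
  scale alpha (scale beta v) = scale (alpha * beta) v.
Proof. by rewrite /scale actM. Qed.
Fact based_scale1 : left_id 1 scale.
Proof. by move=> v; apply: act1. Qed.
Fact based_scaleDr : right_distributive scale +%R.
Proof.
move=> alpha u v; rewrite /scale.
by have := act_heapr alpha o u o v; rewrite actaa.
Qed.
Fact based_scaleDl v : {morph scale^~ v : alpha beta / alpha + beta}.
Proof.
move=> alpha beta; rewrite /scale -[alpha in LHS]subr0.
by have := act_heapl o v alpha 0 beta; rewrite act0.
Qed.

HB.instance Definition _ := GRing.Zmodule_isLmodule.Build K (based o)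
  based_scaleA based_scale1 based_scaleDr based_scaleDl.

Lemma heap_based (a b c : based o) : heap (a : A) b c = a - b + c.
Proof.
rewrite /GRing.opp /GRing.add /= /add /opp.
by rewrite -heapA heapKr heapA heapKl.
Qed.

Lemma act_based alpha (a b : based o) :
  act alpha (a : A) b = alpha *: b - alpha *: a + a.
Proof. by rewrite (act_base alpha a b o) heap_based. Qed.

Definition linear_part (f : A -> A) : based o -> based o :=
  fun a => heap (f a) (f o) o.

Lemma linear_partE (f : based o -> based o) (a : based o) :
  linear_part f a = f a - f 0.
Proof. by rewrite /linear_part heap_based; apply: addr0. Qed.

Lemma affine_sub_linear (f : based o -> based o) :
  @affine_morphism K A A f -> linear (fun a => f a - f 0).
Proof.
move=> [fh fa] alpha u v /=.
have -> : f (alpha *: u + v) = heap (f (act alpha o u)) (f o) (f v) by rewrite -fh.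
rewrite fa act_based heap_based addrK -addrA.
by rewrite scalerBr.
Qed.

End BasedModule.

Arguments linear_part {K A} o f _.
Arguments affine_sub_linear {K A} o [f].

(* The third mixed difference at 0 kills the terms of degree < 3 in the affine
   Jacobi identity and leaves the Jacobi identity of the linearized bracket. *)
Section MixedDifference.
Variable V : zmodType.
Implicit Type F : V -> V -> V -> V.

Definition mixed F (a b c : V) : V :=
  (F a b c + F a 0 0 + F 0 b 0 + F 0 0 c)
  - (F 0 b c + F a 0 c + F a b 0 + F 0 0 0).

Lemma mixedD F G a b c :
  mixed (fun x y z => F x y z + G x y z) a b c = mixed F a b c + mixed G a b c.
Proof.
have sum4 (x1 x2 x3 x4 y1 y2 y3 y4 : V) :
    (x1 + y1) + (x2 + y2) + (x3 + y3) + (x4 + y4) =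
    (x1 + x2 + x3 + x4) + (y1 + y2 + y3 + y4).
  by rewrite (addrACA x1) (addrACA (x1 + x2)) (addrACA (x1 + x2 + x3)).
by rewrite /mixed [RHS]addrACA -opprD -!sum4.
Qed.

Lemma mixed_cycle F a b c :
  mixed (fun x y z => F y z x) a b c = mixed F b c a.
Proof.
rewrite /mixed; congr (_ - _); first by rewrite [LHS](ACl (1*3*4*2)).
by rewrite [LHS](ACl (2*3*1*4)).
Qed.

Lemma mixed1 (f : V -> V) a b c : mixed (fun x _ _ => f x) a b c = 0.
Proof.
by apply/eqP; rewrite subr_eq0; apply/eqP; rewrite [LHS](ACl (3*1*2*4)).
Qed.

End MixedDifference.

Section BasedLie.
Variables (K : comPzRingType) (A : lieAffgebraType K) (o : A).

Local Notation V := (based o).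

Definition lie_at (a b : A) : A :=
  heap5 (abr a b) (abr a o) (abr o o) (abr o b) o.

Let br (a b : V) : V := abr a b.

Lemma lie_atE (a b : V) :
  lie_at a b = br a b - br a 0 + br 0 0 - br 0 b.
Proof. by rewrite /lie_at /heap5 !(@heap_based K A o) -[RHS]addr0. Qed.

Let lie_atEr (a b : V) :
  lie_at a b = (br a b - br a 0) - (br 0 b - br 0 0).
Proof. by rewrite lie_atE opprB addrA. Qed.

Let lie_atEl (a b : V) :
  lie_at a b = (br a b - br 0 b) - (br a 0 - br 0 0).
Proof. by rewrite lie_atE opprB addrA [LHS](ACl (1*4*3*2)). Qed.

Let linear_sub (f g : V -> V) : linear f -> linear g -> linear (fun x => f x - g x).
Proof.
by move=> lf lg alpha u v; rewrite lf lg opprD addrACA scalerBr.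
Qed.

Fact lie_at_linearr (a : V) : linear (lie_at a : V -> V).
Proof.
move=> alpha u v; rewrite 3!lie_atEr.
have [Hr _] := @abr_biaffine K A.
exact: (linear_sub (affine_sub_linear o (Hr a)) (affine_sub_linear o (Hr o))).
Qed.

Fact lie_at_linearl (b : V) : linear (lie_at^~ b : V -> V).
Proof.
move=> alpha u v; rewrite 3!lie_atEl.
have [_ Hl] := @abr_biaffine K A.
exact: (linear_sub (affine_sub_linear o (Hl b)) (affine_sub_linear o (Hl o))).
Qed.

Fact lie_atxx (a : V) : lie_at a a = 0 :> V.
Proof.
have := abr_antisym a o; rewrite (@heap_based K A o) => H.
have {H} : br a 0 - br a a + br 0 a = br 0 0 by [].
move=> H; rewrite lie_atE -H.
by rewrite -!addrA subrr addr0 addKr subrr.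
Qed.

Let mixed_lie a b c :
  mixed (fun x y z => br x (br y z)) a b c = lie_at a (lie_at b c).
Proof.
have [Hr _] := @abr_biaffine K A.
have E x : br x (lie_at b c) - br x 0 =
    br x (br b c) - br x (br b 0) + br x (br 0 0) - br x (br 0 c).
  have -> : br x (lie_at b c) = heap5 (br x (br b c)) (br x (br b 0))
      (br x (br 0 0)) (br x (br 0 c)) (br x 0).
    by rewrite /br /lie_at /heap5 !(Hr x).1.
  by rewrite /heap5 !(@heap_based K A o) addrK.
rewrite [RHS]lie_atEr !E /mixed !opprD !opprK.
by rewrite !addrA [LHS](ACl (1*7*2*6*5*3*8*4)).
Qed.

Fact lie_at_jacobi (a b c : V) :
  (lie_at a (lie_at b c) : V) + lie_at b (lie_at c a) + lie_at c (lie_at a b)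
  = 0.
Proof.
pose F x y z : V := br x (br y z).
pose D (x y z : V) : V := br x x.
have cyc2 G : mixed (fun x y z => G z x y) a b c = mixed G c a b.
  by rewrite (mixed_cycle (fun x y z => G y z x)) mixed_cycle.
rewrite -3!mixed_lie -/F -(mixed_cycle F a b c) -(cyc2 F) -2!mixedD.
transitivity (mixed (fun x y z => D x y z + D y z x + D z x y) a b c).
  have J x y z : F x y z + F y z x + F z x y = D x y z + D y z x + D z x y.
    have := abr_jacobi x y z; rewrite /heap5 !(@heap_based K A o) => J.
    have {}J : F x y z - D x y z + F y z x - D y z x + F z x y = D z x y by [].
    by rewrite -J !addrA [RHS](ACl (3*5*7*(1*4)*(2*6))) /= !subrr !addr0.
  by rewrite /mixed !J.
have D0 x y z : mixed D x y z = 0 by apply: (mixed1 (fun t => br t t)).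
rewrite 2!mixedD (mixed_cycle D) (cyc2 D) [mixed D c a b]D0 [mixed D b c a]D0.
by rewrite !addr0; apply: D0.
Qed.

HB.instance Definition _ := Lmodule_isLieAlgebra.Build K (based o)
  lie_at_linearr lie_at_linearl lie_atxx lie_at_jacobi.

End BasedLie.

(* Main.v *)
(** Linearizing at [o] turns the bracket and [N] into their (mixed) differences:
    [lie (x - x') (y - y')] is the second difference of the affine bracket, and
    [N_o] sends a second difference to the second difference of the [N]-images.
    Taking the second difference of the affine Nijenhuis identity with respect
    to the pairs [(a, 0)] and [(b, 0)] therefore yields the linear one. *)

Require Import Defs.
From HB Require Import structures.
From mathcomp Require Import all_boot all_algebra.

Set Implicit Arguments.
Unset Strict Implicit.
Unset Printing Implicit Defensive.

Import GRing.Theory.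
Local Open Scope ring_scope.

Section SecondDifference.
Variable V : zmodType.

Lemma subrBB (x y z t : V) : (x - y) - (z - t) = (x - z) - (y - t).
Proof. by rewrite !opprD addrACA. Qed.

(** The entries are values at the corners of a square in cyclic order, so that the signs
    alternate. *)
Definition diff2 (p q r s : V) : V := p - q + r - s.

Lemma diff2B p q r s p' q' r' s' :
  diff2 p q r s - diff2 p' q' r' s' =
  diff2 (p - p') (q - q') (r - r') (s - s').
Proof.
rewrite /diff2 !opprD !opprK !addrA.
by rewrite [LHS](ACl (1*5*2*6*3*7*4*8)).
Qed.

Lemma diff2D p q r s p' q' r' s' :
  diff2 p q r s + diff2 p' q' r' s' =
  diff2 (p + p') (q + q') (r + r') (s + s').
Proof.
rewrite /diff2 !opprD !addrA.
by rewrite [LHS](ACl (1*5*2*6*3*7*4*8)).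
Qed.

End SecondDifference.

Section LinearPart.
Variables (K : comPzRingType) (A : affineModType K) (o : A).
Local Notation V := (based o).

Lemma linear_part_linear (f : A -> A) :
  affine_morphism f -> linear (linear_part o f : V -> V).
Proof.
move=> hf alpha u v; rewrite !linear_partE.
exact: (affine_sub_linear o hf).
Qed.

(** The signs cancel in pairs, and so do the constants [f 0] subtracted by [linear_part]. *)
Lemma linear_part_diff2 (f : V -> V) (p q r s : V) :
  @affine_morphism K A A f ->
  linear_part o f (diff2 p q r s) = diff2 (f p) (f q) (f r) (f s) :> V.
Proof.
move=> hf.
have fB : {morph (linear_part o f : V -> V) : x y / x - y}.
  exact: zmod_morphism_linear (linear_part_linear hf).
have -> : diff2 p q r s = (p - q) - (s - r) by rewrite /diff2 opprB addrA.
by rewrite !fB !linear_partE !opprB !subrKA addrA.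
Qed.

End LinearPart.

Section BasedLie.
Variables (K : comPzRingType) (A : lieAffgebraType K) (o : A).
Local Notation V := (based o).
Let br (x y : V) : V := abr (x : A) y.

(** Bilinearity expands the left side into four brackets; the base-point terms that [lieE] puts into
    each of them cancel. *)
Lemma lie_subB (x x' y y' : V) :
  lie (x - x') (y - y') = diff2 (br x y) (br x y') (br x' y') (br x' y).
Proof.
have lieBr z : {morph lie (z : V) : u v / u - v}.
  exact: zmod_morphism_linear (lie_linearr z).
have lieBl z : {morph lie^~ (z : V) : u v / u - v}.
  exact: zmod_morphism_linear (lie_linearl z).
have lieE u v : lie u v = (br u v - br u 0) - (br 0 v - br 0 0).
  by rewrite [LHS]lie_atE opprB addrA.
have lieBrE z : lie z (y - y') = (br z y - br z y') - (br 0 y - br 0 y').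
  by rewrite lieBr !lieE subrBB; congr (_ - _); rewrite !opprB subrKA.
by rewrite lieBl !lieBrE subrBB subrr subr0 opprB addrA.
Qed.

End BasedLie.

Theorem theorem4p9 (K : comPzRingType) (A : lieAffgebraType K) (N : A -> A)
    (hN : affgebra_nijenhuis N) (o : A) :
  @lie_nijenhuis K (based o) (linear_part o N).
Proof.
have [N_affine N_nij] := hN.
split=> [|a b]; first exact: linear_part_linear.
pose n : based o -> based o := N.
pose br (x y : based o) : based o := abr (x : A) y.
have nijE x y : br (n x) (n y) = n (br (n x) y - n (br x y) + br x (n y)).
  by rewrite -(@heap_based K A o); apply: N_nij.
have T x : linear_part o N x = n x - n 0 :> based o by apply: linear_partE.
have lieB (x x' y y' : based o) : lie (x - x') (y - y') =
    diff2 (br x y) (br x y') (br x' y') (br x' y) by apply: lie_subB.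
(* An argument that is not a difference is read as [x - 0], where [0] is [o]. *)
have lieE x y : lie x y = diff2 (br x y) (br x 0) (br 0 0) (br 0 y).
  by rewrite -lieB !subr0.
have lieBl x x' y :
    lie (x - x') y = diff2 (br x y) (br x 0) (br x' 0) (br x' y).
  by rewrite -lieB subr0.
have lieBr x y y' :
    lie x (y - y') = diff2 (br x y) (br x y') (br 0 y') (br 0 y).
  by rewrite -lieB subr0.
rewrite (T a) (T b) lieB lieBl lieBr lieE !(linear_part_diff2 (f := n)) //.
(* Every [diff2] lists its corners as [(a, b)], [(a, 0)], [(0, 0)], [(0, b)], so the three on the
   right merge entrywise into the arguments of the outer [n] in [nijE]. *)
by rewrite diff2B diff2D (linear_part_diff2 (f := n)) // !nijE.
Qed.
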